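(* Let $k>0$, $\varepsilon\in(0,1)$, $\alpha,\beta>0$, $C(L,T)=\alpha L+\beta T$, and suppose $m\ge n\ge \frac{16k}{\varepsilon}$. Let $(L^*,T^* )$ be an optimal solution of the problem $$\text{minimize } C(L,T)\quad\text{subject to}\quad (T-1)f\Big(\frac{L}{T-1}\Big)\ge N-2k^2,\quad T\ge 2,\ L>0,$$ and let $d^*=\min\{\frac{L^*}{T^*-1},2k\}$. Then a type-$d^*$ up-and-down path provides a $(1+\varepsilon)$-approximate solution for the RC-CPPG with objective $C$: it is a covering path, and its path length $L'$ and stop count $T'$ satisfy $C(L',T')\le(1+\varepsilon)\,C(L,T)$ for every covering path with path length $L$ and stop count $T$.
   Context: Let $m\ge n\ge 1$ be integers, $N=mn$, $D=\{(x,y)\in\mathbb{R}^2: 0\le x\le n,\ 0\le y\le m\}$. Distances are $\ell_1$ distances. The function $f$ is $f(d)=d(2k-\frac d2)$ for $d\in(0,2k]$ and $f(d)=2k^2$ for $d>2k$. RC-CPPG with coverage radius $k$: a covering path is a finite sequence $F_1,\dots,F_T$ of distinct points of $D$ (stops) such that every point of $D$ is within $\ell_1$ distance $k$ of some $F_i$; its stop count is $T$ and its path length is $\sum_{i=1}^{T-1}\|F_{i+1}-F_i\|_1$ (or the length of a prescribed path visiting the stops in this order). The problem is to minimize $C(\text{path length},\text{stop count})$ over covering paths. Type-$d$ up-and-down path ($0<d\le 2k$): put $r=2k-\frac d2$. The path has vertical traversals, i.e. the segments from $(s,0)$ to $(s,m)$, at $s=0,r,2r,\dots,\lfloor n/r\rfloor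 r$, and, if $n/r$ is not an integer, a last traversal at $s=n$. It goes up the first traversal, moves horizontally along the top side to the second, goes down the second, moves horizontally along the bottom side to the third, and so on: $(0,0)\to(0,m)\to(r,m)\to(r,0)\to(2r,0)\to(2r,m)\to\cdots$. On the 1st, 3rd, 5th, ... traversals there are stops at heights $jd$ ($j=0,1,2,\dots$, $jd\le m$); on the 2nd, 4th, ... traversals there are stops at heights $jd+\frac d2$ ($j=0,1,\dots$, $jd+\frac d2\le m$); in addition every traversal has a stop at height $m$. Its path length is the length of this polygonal path. *)

(* Defs.v *)
From mathcomp Require Import all_boot all_order all_algebra.
From mathcomp Require Import reals.

Set Implicit Arguments.
Unset Strict Implicit.
Unset Printing Implicit Defensive.

Import Order.TTheory GRing.Theory Num.Theory.
Local Open Scope ring_scope.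

Definition l1dist (R : realType) (p q : R * R) : R :=
  `|p.1 - q.1| + `|p.2 - q.2|.

Definition in_rect (R : realType) (m n : nat) (p : R * R) : bool :=
  (0 <= p.1 <= n%:R) && (0 <= p.2 <= m%:R).

Definition poly_length (R : realType) (V : seq (R * R)) : R :=
  \sum_(i < (size V).-1) l1dist V`_i.+1 V`_i.

(* The polygonal path with vertices V, parametrized by [0, size V - 1]:
   the i-th edge is run through affinely while u goes from i to i + 1. *)
Fixpoint poly_point (R : realType) (V : seq (R * R)) (u : R) : R * R :=
  match V with
  | [::] => 0
  | p :: V' =>
    if V' is q :: _ then
      if u <= 1 then (p.1 + u * (q.1 - p.1), p.2 + u * (q.2 - p.2))
      else poly_point V' (u - 1)
    else p
  end.

Definition visits_in_order (R : realType) (V F : seq (R * R)) : Prop :=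
  exists u : seq R,
    [/\ sorted <=%R u,
        all (fun x => 0 <= x <= (size V).-1%:R) u
      & F = map (poly_point V) u].

(* F is the sequence of stops and V lists the vertices of the path followed:
   the stop count is size F and the path length is poly_length V.  The choice
   V = F gives the sum of the distances between consecutive stops. *)
Definition covering_path (R : realType) (m n : nat) (k : R)
    (F V : seq (R * R)) : Prop :=
  [/\ uniq F,
      all (in_rect m n) F,
      forall p, in_rect m n p -> exists2 q, q \in F & l1dist p q <= k
    & visits_in_order V F].

Definition cost (R : realType) (alpha beta L T : R) : R :=
  alpha * L + beta * T.

(* Only the values at d > 0 are meaningful. *)
Definition cover_area (R : realType) (k d : R) : R :=
  if d <= 2 * k then d * (2 * k - d / 2) else 2 * k ^+ 2.

Definition feasible (R : realType) (m n : nat) (k L T : R) : Prop :=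
  [/\ (T - 1) * cover_area k (L / (T - 1)) >= (m * n)%:R - 2 * k ^+ 2,
      2 <= T & 0 < L].

(* TT is the set of values allowed for the variable T. *)
Definition optimal (R : realType) (m n : nat) (k alpha beta : R)
    (TT : R -> Prop) (L T : R) : Prop :=
  [/\ feasible m n k L T, TT T
    & forall L' T', feasible m n k L' T' -> TT T' ->
        cost alpha beta L T <= cost alpha beta L' T'].

Definition trav_gap (R : realType) (k d : R) : R := 2 * k - d / 2.

Definition traversals (R : realType) (n : nat) (k d : R) : seq R :=
  let r := trav_gap k d in
  let s := [seq i%:R * r | i <- iota 0 (Num.truncn (n%:R / r)).+1] in
  if n%:R / r \is a Num.int then s else rcons s n%:R.

(* Increasing list of the stop heights c + j d <= m, completed with m; undup
   prevents m from being listed twice.  For c >= 0 the bound on j is implied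
   by c + j d <= m. *)
Definition heights (R : realType) (m : nat) (d c : R) : seq R :=
  undup (rcons [seq h <- [seq c + j%:R * d
                         | j <- iota 0 (Num.truncn (m%:R / d)).+1]
                      | h <= m%:R] m%:R).

(* Traversals are numbered from 0, so the 1st, 3rd, ... (upward) ones are those
   of even index. *)
Definition updown_stops (R : realType) (m n : nat) (k d : R) : seq (R * R) :=
  let s := traversals n k d in
  flatten [seq [seq (s`_i, h) | h <- if odd i then rev (heights m d (d / 2))
                                     else heights m d 0]
          | i <- iota 0 (size s)].

Definition updown_vertices (R : realType) (m n : nat) (k d : R) :
    seq (R * R) :=
  let s := traversals n k d in
  flatten [seq if odd i then [:: (s`_i, m%:R); (s`_i, 0)]
               else [:: (s`_i, 0); (s`_i, m%:R)]
          | i <- iota 0 (size s)].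

(* Main.v *)
Require Import Defs.
From mathcomp Require Import all_boot all_order all_algebra.
From mathcomp Require Import reals.
From mathcomp Require Import zify ring lra.

(* Lower bound: two l1-balls of radius k whose centers are at distance d differ
   by an area of at most f(d), so covering D forces
   mn - 2k^2 <= sum_i f(d_i) <= (T - 1) f(L / (T - 1)), the second step by
   concavity and monotonicity of f.  Hence every covering path is feasible for
   the optimization problem.  Areas are replaced by counts of lattice points of
   mesh 1/q, with q going to infinity.

   Upper bound: with r = 2k - d/2, feasibility gives
   r L* >= mn - 2k^2 and r d (T* - 1) >= mn - 2k^2, while the up-and-down path
   has at most n/r + 2 traversals with at most m/d + 2 stops each.  Since
   16k <= eps n, the boundary terms only cost a factor 1 + eps, separately for
   the length and for the number of stops. *)

Set Implicit Arguments.
Unset Strict Implicit.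
Unset Printing Implicit Defensive.

Import Order.TTheory GRing.Theory Num.Theory.
Local Open Scope ring_scope.

(** * Arc length along a polygonal path *)

Lemma l1dist_ge0 (R : realType) (p q : R * R) : 0 <= l1dist p q.
Proof. by rewrite addr_ge0. Qed.

Lemma l1distC (R : realType) (p q : R * R) : l1dist p q = l1dist q p.
Proof. by rewrite /l1dist distrC [X in _ + X]distrC. Qed.

Lemma l1dist_trans (R : realType) (q p r : R * R) :
  l1dist p r <= l1dist p q + l1dist q r.
Proof.
rewrite /l1dist addrACA lerD //.
  by rewrite -[p.1 - r.1](subrKA q.1) ler_normD.
by rewrite -[p.2 - r.2](subrKA q.2) ler_normD.
Qed.

(** Since |a| + |b| is the maximum of |a + b| and |a - b|, an l1-ball is a square in the coordinates
    x + y, x - y. *)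
Lemma l1dist_le (R : realType) (p q : R * R) (k : R) :
  (l1dist p q <= k) =
  (`|p.1 + p.2 - (q.1 + q.2)| <= k) && (`|p.1 - p.2 - (q.1 - q.2)| <= k).
Proof.
rewrite /l1dist; apply/idP/idP; last first.
  move=> /andP[]; rewrite !ler_norml => /andP[h1 h2] /andP[h3 h4].
  by case: (ger0P (p.1 - q.1)) => h5; case: (ger0P (p.2 - q.2)) => h6; lra.
by case: (ger0P (p.1 - q.1)) => h5; case: (ger0P (p.2 - q.2)) => h6 h;
  apply/andP; split; rewrite ler_norml; apply/andP; split; lra.
Qed.

Lemma poly_length_cons2 (R : realType) (p q : R * R) V :
  poly_length (p :: q :: V) = l1dist q p + poly_length (q :: V).
Proof. by rewrite /poly_length /= big_ord_recl. Qed.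

Lemma poly_length_ge0 (R : realType) (V : seq (R * R)) : 0 <= poly_length V.
Proof. by apply: sumr_ge0 => i _; exact: l1dist_ge0. Qed.

(** Same recursion as [poly_point], so that the two can be compared edge by edge; past the last
    vertex it stays at [poly_length V]. *)
Fixpoint arc_length (R : realType) (V : seq (R * R)) (u : R) : R :=
  match V with
  | [::] => 0
  | p :: V' =>
    if V' is q :: _ then
      if u <= 1 then u * l1dist q p else l1dist q p + arc_length V' (u - 1)
    else 0
  end.

Lemma poly_point_cons2 (R : realType) (p q : R * R) V (u : R) :
  poly_point (p :: q :: V) u =
  if u <= 1 then (p.1 + u * (q.1 - p.1), p.2 + u * (q.2 - p.2))
  else poly_point (q :: V) (u - 1).
Proof. by []. Qed.

Lemma arc_length_cons2 (R : realType) (p q : R * R) V (u : R) :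
  arc_length (p :: q :: V) u =
  if u <= 1 then u * l1dist q p else l1dist q p + arc_length (q :: V) (u - 1).
Proof. by []. Qed.

Lemma arc_length_bounds (R : realType) (V : seq (R * R)) (u : R) :
  0 <= u -> 0 <= arc_length V u <= poly_length V.
Proof.
elim: V u => [|p [|q V] IH] u u0; try by rewrite lexx poly_length_ge0.
rewrite poly_length_cons2 arc_length_cons2; have d0 := l1dist_ge0 q p.
case: (leP u 1) => u1; last first.
  have /IH : 0 <= u - 1 by rewrite subr_ge0 ltW.
  lra.
have := poly_length_ge0 (q :: V); nra.
Qed.

Lemma arc_length0 (R : realType) (V : seq (R * R)) : arc_length V 0 = 0.
Proof. by case: V => [|p [|q V]] //=; rewrite ler01 mul0r. Qed.

Lemma poly_point0 (R : realType) (p : R * R) V : poly_point (p :: V) 0 = p.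
Proof. by case: V => [|q V] //=; rewrite ler01 !mul0r !addr0; case: p. Qed.

Lemma l1dist_poly_point (R : realType) (V : seq (R * R)) (u v : R) :
  0 <= u -> u <= v ->
  l1dist (poly_point V u) (poly_point V v) <= arc_length V v - arc_length V u.
Proof.
elim: V u v => [|p V IH] u v u0 uv.
  by rewrite /= /l1dist !subrr normr0 addr0.
case: V IH => [|q V] IH; first by rewrite /= /l1dist !subrr normr0 addr0.
rewrite !poly_point_cons2 !arc_length_cons2.
have seg a b : a <= b ->
    l1dist (p.1 + a * (q.1 - p.1), p.2 + a * (q.2 - p.2))
           (p.1 + b * (q.1 - p.1), p.2 + b * (q.2 - p.2)) =
    (b - a) * l1dist q p.
  move=> ab.
  have E x y : `|x + b * (y - x) - (x + a * (y - x))| = (b - a) * `|y - x|.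
    rewrite -[in RHS](ger0_norm (x := b - a)) ?subr_ge0 // -normrM.
    by congr `|_|; ring.
  by rewrite l1distC /l1dist /= !E mulrDr.
case: (leP v 1) => v1.
  by rewrite (le_trans uv v1) seg // mulrBl.
case: (leP u 1) => u1; last first.
  have := IH (u - 1) (v - 1); rewrite subr_ge0 lerD2r => /(_ (ltW u1) uv); lra.
(* Here [u] is on the first edge and [v] beyond it: the triangle inequality goes through the vertex
   [q], at parameter 1 of this edge and 0 of the rest. *)
have := IH 0 (v - 1) (lexx _); rewrite subr_ge0 => /(_ (ltW v1)).
rewrite poly_point0 arc_length0 subr0 => h.
apply: le_trans (l1dist_trans q _ _) _.
have := seg u 1 u1; rewrite !mul1r.
have -> : (p.1 + (q.1 - p.1), p.2 + (q.2 - p.2)) = q.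
  by case: (q) => a b; congr (_, _) => /=; ring.
move=> ->; move: h; rewrite /=; lra.
Qed.

Lemma sum_l1dist_visits (R : realType) (V F : seq (R * R)) (f : R * R) :
  visits_in_order V (f :: F) ->
  \sum_(d <- pairmap (@l1dist R) f F) d <= poly_length V.
Proof.
case=> -[[_ _ //]|u us [/= srt /andP[/andP[u0 _] us0] [-> ->]]].
(* The induction on the later parameters needs the sharper bound by the length that remains after
   [u]. *)
suff H : \sum_(d <- pairmap (@l1dist R) (poly_point V u)
                            (map (poly_point V) us)) d
    <= poly_length V - arc_length V u.
  by apply: le_trans H _; have := arc_length_bounds V u0; lra.
elim: us u srt u0 us0 => [|v us IH] u /=.
  by move=> _ u0 _; rewrite big_nil; have := arc_length_bounds V u0; lra.
case/andP=> uv srt u0 /andP[/andP[v0 _] us0]; rewrite big_cons.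
have := IH v srt v0 us0; have := l1dist_poly_point V u0 uv; lra.
Qed.

(** * Area bound by lattice point counting *)

(** [cover_area k] is concave and nondecreasing, and [Num.max 0 (2 * k - mu)] is its derivative at
    [mu], so its graph lies below the tangent there. *)
Lemma cover_area_tangent (R : realType) (k mu d : R) : 0 < k ->
  cover_area k d <= cover_area k mu + Num.max 0 (2 * k - mu) * (d - mu).
Proof.
move=> k0; rewrite /cover_area.
have h0 := sqr_ge0 (d - mu); have h1 := sqr_ge0 (2 * k - mu).
have h2 := sqr_ge0 (2 * k - d).
case: (leP mu (2 * k)) => hmu.
  rewrite max_r ?subr_ge0 //; case: (leP d (2 * k)) => hd; first by nra.
  have : 0 <= (2 * k - mu) * (d - 2 * k) by rewrite mulr_ge0 ?subr_ge0 // ltW.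
  nra.
rewrite max_l; last by rewrite subr_le0 ltW.
case: (leP d (2 * k)) => hd; nra.
Qed.

(* The slope of the tangent is nonnegative, so an upper bound on the sum
   suffices. *)
Lemma sum_cover_area_le (R : realType) (k mu : R) (s : seq R) : 0 < k ->
  \sum_(d <- s) d <= (size s)%:R * mu ->
  \sum_(d <- s) cover_area k d <= (size s)%:R * cover_area k mu.
Proof.
move=> k0 hs.
have : \sum_(d <- s) cover_area k d <= (size s)%:R * cover_area k mu
   + Num.max 0 (2 * k - mu) * (\sum_(d <- s) d - (size s)%:R * mu).
  elim: (s) => [|d t IH] /=; first by rewrite !big_nil; lra.
  rewrite !big_cons -natr1; have := cover_area_tangent mu d k0; lra.
have : 0 <= Num.max 0 (2 * k - mu) by rewrite le_max lexx.
nra.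
Qed.

Lemma int_itv_offset (R : realType) (u w : R) (i : int) :
  u <= i%:~R <= u + w ->
  exists2 a : nat, i = Num.ceil u + a%:Z & (a < (Num.truncn w).+1)%N.
Proof.
case/andP=> ui iw; have ci : Num.ceil u <= i by rewrite ceil_le_int.
exists `|i - Num.ceil u|%N; first by rewrite gez0_abs ?subr_ge0 //; ring.
have h : `|i - Num.ceil u|%:R <= w :> R.
  have -> : `|i - Num.ceil u|%:R = i%:~R - (Num.ceil u)%:~R :> R.
    by rewrite pmulrn gez0_abs ?subr_ge0 // intrB.
  have := ceil_ge u; lra.
by rewrite ltnS truncn_ge_nat // (le_trans _ h).
Qed.

(** An interval of length w contains at most w + 1 integers; the offsets from the ceilings of [u]
    and [v] embed [A] into a product of two ordinals. *)
Lemma card_int_box (R : realType) (P : finType) (phi : P -> int * int)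
  (A : {set P}) (u v w w' : R) : injective phi -> 0 <= w -> 0 <= w' ->
  {in A, forall p, (u <= (phi p).1%:~R <= u + w) &&
                   (v <= (phi p).2%:~R <= v + w')} ->
  #|A|%:R <= (w + 1) * (w' + 1).
Proof.
move=> inj w0 w'0 H.
pose g p : 'I_(Num.truncn w).+1 * 'I_(Num.truncn w').+1 :=
  (inord `|(phi p).1 - Num.ceil u|%N, inord `|(phi p).2 - Num.ceil v|%N).
have ginj : {in A &, injective g}.
  move=> p p' /H/andP[/int_itv_offset[a1 e1 l1] /int_itv_offset[a2 e2 l2]].
  move=> /H/andP[/int_itv_offset[b1 f1 m1] /int_itv_offset[b2 f2 m2]].
  rewrite /g e1 e2 f1 f2 ![_ + Posz _]addrC !addrK /= => -[].
  move=> /(congr1 val); rewrite /= !inordK // => h1.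
  move=> /(congr1 val); rewrite /= !inordK // => h2.
  apply: inj; rewrite [LHS]surjective_pairing [RHS]surjective_pairing.
  by rewrite e1 e2 f1 f2 h1 h2.
have := max_card (mem (g @: A)); rewrite card_in_imset // card_prod !card_ord.
rewrite -(ler_nat R) => /le_trans; apply.
by rewrite natrM ler_pM // -natr1 lerD2r truncn_le.
Qed.

(** What the interval of radius k about s has outside the one about s' lies at its end away from
    s'. *)
Lemma slice_bounds (R : realType) (k s s' x : R) :
  `|x - s| <= k -> k < `|x - s'| ->
  (if s' <= s then s' + k else s - k) <= x
    <= (if s' <= s then s' + k else s - k) + `|s - s'|.
Proof.
rewrite ler_norml ltr_normr => /andP[h1 h2] h3 /=.
case: (leP s' s) => h4.
  rewrite ger0_norm ?subr_ge0 //; case/orP: h3 => h3; lra.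
rewrite ltr0_norm ?subr_lt0 //; case/orP: h3 => h3; lra.
Qed.

(* The points of the rectangle of the form ((i + b/2) / q, (j + b/2) / q) with
   b a bit.  In the coordinates x + y, x - y, where l1-balls are squares, they
   are integer points divided by q. *)
Definition lattice (m n q : nat) : finType :=
  ('I_(n * q) * 'I_(m * q) * bool)%type.

Definition lattice_pt (R : realType) m n q (p : lattice m n q) : R * R :=
  let: (i, j, b) := p in
  ((i%:R + b%:R / 2) / q%:R, (j%:R + b%:R / 2) / q%:R).

Definition lattice_diag m n q (p : lattice m n q) : int * int :=
  let: (i, j, b) := p in ((i + j + b)%N%:Z, i%:Z - j%:Z).

(** i + j and i - j have the same parity, so the parities of the two coordinates determine the bit
    b, and then i and j. *)
Lemma lattice_diag_inj m n q : injective (@lattice_diag m n q).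
Proof.
move=> [[i j] b] [[i' j'] b'] [/= h1 h2].
have hb : b = b' by case: b h1; case: b' => //=; lia.
by subst b'; congr (_, _, _); apply: val_inj => /=; lia.
Qed.

(** The factor 2 is the absolute determinant of (x, y) -> (x + y, x - y): counts divided by q^2
    approximate areas in the rotated coordinates. *)
Lemma card_lattice m n q : #|lattice m n q| = (2 * (m * n) * q ^ 2)%N.
Proof. by rewrite !card_prod !card_ord card_bool; ring. Qed.

Lemma lattice_pt_in (R : realType) m n q (p : lattice m n q) :
  in_rect m n (@lattice_pt R m n q p).
Proof.
case: p => [[i j] b]; rewrite /in_rect /=.
have q0 : 0 < q%:R :> R.
  by rewrite ltr0n; have := ltn_ord i; nia.
have b1 : 0 <= (b%:R : R) <= 1 by case: b; rewrite ?lexx ?ler01.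
have aux l (a : 'I_(l * q)) : 0 <= ((a%:R : R) + b%:R / 2) / q%:R <= l%:R.
  have a0 : 0 <= a%:R :> R by exact: ler0n.
  have al : a%:R + 1 <= l%:R * q%:R :> R by rewrite natr1 -natrM ler_nat.
  apply/andP; split; first by rewrite divr_ge0 ?ler0n //; lra.
  by rewrite ler_pdivrMr //; lra.
by rewrite !aux.
Qed.

Lemma lattice_diagE (R : realType) m n q (p : lattice m n q) : (0 < q)%N ->
  ((lattice_diag p).1%:~R = q%:R * ((lattice_pt R p).1 + (lattice_pt R p).2)) *
  ((lattice_diag p).2%:~R = q%:R * ((lattice_pt R p).1 - (lattice_pt R p).2)).
Proof.
move=> q0; have q0' : q%:R != 0 :> R by rewrite pnatr_eq0 -lt0n.
case: p => [[i j] b] /=; split; last by rewrite intrB -!pmulrn; field.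
by rewrite -pmulrn !natrD; field.
Qed.

Definition lattice_ball (R : realType) m n q (k : R) (f : R * R) :
  {set lattice m n q} := [set p | l1dist (lattice_pt R p) f <= k].

Lemma card_lattice_box (R : realType) m n q (A : {set lattice m n q})
  (u v w w' : R) : (0 < q)%N -> 0 <= w -> 0 <= w' ->
  {in A, forall p,
     (u <= (lattice_pt R p).1 + (lattice_pt R p).2 <= u + w) &&
     (v <= (lattice_pt R p).1 - (lattice_pt R p).2 <= v + w')} ->
  #|A|%:R <= (q%:R * w + 1) * (q%:R * w' + 1).
Proof.
move=> q0 w0 w'0 H; have q0' : 0 < q%:R :> R by rewrite ltr0n.
apply: (card_int_box (u := q%:R * u) (v := q%:R * v) (@lattice_diag_inj m n q));
  rewrite ?mulr_ge0 ?ler0n // => p /H.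
by rewrite !(lattice_diagE R p q0) -!mulrDr !(ler_pM2l q0').
Qed.

Lemma card_lattice_ball (R : realType) m n q (k : R) f : (0 < q)%N -> 0 < k ->
  #|lattice_ball m n q k f|%:R <= (2 * k * q%:R + 1) ^+ 2.
Proof.
move=> q0 k0; rewrite expr2 [2 * k * _]mulrC.
apply: (card_lattice_box (u := f.1 + f.2 - k) (v := f.1 - f.2 - k)) => //;
  try lra.
by move=> p; rewrite inE l1dist_le !ler_norml; lra.
Qed.

(* A square of side 2k minus its translate by (a, b) with |a|, |b| <= d <= 2k
   is covered by an |a| x 2k and a (2k - |a|) x |b| rectangle, of total area
   4k^2 - (2k - |a|)(2k - |b|) <= 4k^2 - (2k - d)^2 = 2 f(d). *)
Lemma card_lattice_ballD (R : realType) m n q (k : R) f g :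
  (0 < q)%N -> 0 < k ->
  #|lattice_ball m n q k f :\: lattice_ball m n q k g|%:R
    <= 2 * cover_area k (l1dist f g) * q%:R ^+ 2 + (6 * k + 2) * q%:R.
Proof.
move=> q0 k0; set d := l1dist f g.
have q1 : 1 <= q%:R :> R by rewrite ler1n.
have kq : 0 <= k * q%:R by rewrite mulr_ge0 ?ler0n // ltW.
rewrite /cover_area; case: (leP d (2 * k)) => hd; last first.
  have := card_lattice_ball m n f q0 k0.
  have : #|lattice_ball m n q k f :\: lattice_ball m n q k g|%:R
       <= #|lattice_ball m n q k f|%:R :> R.
    by rewrite ler_nat subset_leq_card // subsetDl.
  rewrite sqrrD !expr1n exprMn mulr1; lra.
have := lexx d; rewrite {1}/d l1dist_le.
set s := f.1 + f.2; set s' := g.1 + g.2.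
set t := f.1 - f.2; set t' := g.1 - g.2.
set a := `|s - s'|; set b := `|t - t'| => /andP[ad bd].
pose E1 := [set p in lattice_ball m n q k f |
  k < `|(lattice_pt R p).1 + (lattice_pt R p).2 - s'|].
pose E2 := [set p in lattice_ball m n q k f |
  (`|(lattice_pt R p).1 + (lattice_pt R p).2 - s'| <= k) &&
  (k < `|(lattice_pt R p).1 - (lattice_pt R p).2 - t'|)].
have a0 : 0 <= a by exact: normr_ge0.
have b0 : 0 <= b by exact: normr_ge0.
have c1 : #|E1|%:R <= (q%:R * a + 1) * (q%:R * (2 * k) + 1).
  apply: (card_lattice_box (u := if s' <= s then s' + k else s - k)
    (v := t - k)) => //; first by lra.
  move=> p; rewrite !inE l1dist_le -/s -/t => /andP[/andP[h1 h2] h3].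
  by rewrite (slice_bounds h1 h3) /=; move: h2; rewrite ler_norml; lra.
(* In [E2], x + y is within k of both s and s', which leaves an interval of length 2k - a starting
   at max(s, s') - k. *)
have c2 : #|E2|%:R <= (q%:R * (2 * k - a) + 1) * (q%:R * b + 1).
  apply: (card_lattice_box (u := (if s' <= s then s else s') - k)
    (v := if t' <= t then t' + k else t - k)) => //; first by lra.
  move=> p; rewrite !inE l1dist_le -/s -/t => /andP[/andP[h1 h2] /andP[h3 h4]].
  rewrite (slice_bounds h2 h4) andbT; move: h1 h3; rewrite !ler_norml /a.
  case: (leP s' s) => h5; first by rewrite ger0_norm ?subr_ge0 //; lra.
  by rewrite ltr0_norm ?subr_lt0 //; lra.
have : #|lattice_ball m n q k f :\: lattice_ball m n q k g|%:R
    <= #|E1|%:R + #|E2|%:R :> R.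
  rewrite -natrD ler_nat (leq_trans _ (leq_card_setU _ _)) // subset_leq_card //.
  apply/subsetP => p; rewrite !inE => /andP[h ->] /=; move: h.
  rewrite (l1dist_le _ g) -/s' -/t' ltNge.
  by case: (_ <= k) => //=; rewrite ltNge.
move/le_trans; apply; apply: (le_trans (lerD c1 c2)).
have hab : (2 * k - d) ^+ 2 <= (2 * k - a) * (2 * k - b).
  by rewrite expr2 ler_pM //; lra.
have := ler_wpM2r (sqr_ge0 q%:R) hab.
(* The terms of lower order in q add up to (4k + b) q + 2, at most (6k + 2) q because b <= 2k and q
   >= 1. *)
have : b * q%:R <= 2 * k * q%:R by rewrite ler_pM2r ?ltr0n //; lra.
nra.
Qed.

(** In the union, the last ball counts in full and every other one only by its part outside the next
    ball. *)
Lemma lattice_count (R : realType) m n q (k : R) (f : R * R) F :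
  (0 < q)%N -> 0 < k ->
  #|[set p | has (fun g => p \in lattice_ball m n q k g) (f :: F)]|%:R
    <= (2 * k * q%:R + 1) ^+ 2
       + \sum_(d <- pairmap (@l1dist R) f F)
           (2 * cover_area k d * q%:R ^+ 2 + (6 * k + 2) * q%:R).
Proof.
move=> q0 k0; elim: F f => [|g F IH] f.
  rewrite big_nil addr0.
  have -> : [set p | has (fun g => p \in lattice_ball m n q k g) [:: f]] =
            lattice_ball m n q k f by apply/setP => p; rewrite !inE /= orbF ?inE.
  exact: card_lattice_ball.
rewrite /= big_cons addrCA; 
apply: le_trans (lerD (card_lattice_ballD m n f g q0 k0) (IH g)).
rewrite -natrD ler_nat (leq_trans _ (leq_card_setU _ _)) // subset_leq_card //.
apply/subsetP => p; rewrite !inE /= !inE.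
by case: (_ <= k) => //=; case: (_ <= k) => //=.
Qed.

Lemma covering_area (R : realType) m n (k : R) (f : R * R) F : 0 < k ->
  (forall p, in_rect m n p -> exists2 q, q \in f :: F & l1dist p q <= k) ->
  (m * n)%:R - 2 * k ^+ 2 <= \sum_(d <- pairmap (@l1dist R) f F) cover_area k d.
Proof.
move=> k0 cov; apply/ler_addgt0Pr => e e0.
set S := \sum_(d <- _) _; set T := size F.
(* [C * q] bounds all terms of lower order than q^2 in [lattice_count]; after division by q^2 the
   error C / q is below e. *)
pose C := 4 * k + 1 + T%:R * (6 * k + 2).
have C0 : 0 < C.
  have : 0 <= T%:R * (6 * k + 2) by apply: mulr_ge0; [exact: ler0n | lra].
  by rewrite /C; lra.
pose q := (Num.truncn (C / e)).+1.
have qe : C < e * q%:R by rewrite mulrC -ltr_pdivrMr // truncnS_gt.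
have q1 : 1 <= q%:R :> R by rewrite ler1n.
have := @lattice_count R m n q k f F isT k0.
have -> : [set p | has (fun g => p \in lattice_ball m n q k g) (f :: F)] = setT.
  apply/setP => p; rewrite !inE; have [g gF hg] := cov _ (lattice_pt_in R p).
  by apply/hasP; exists g => //; rewrite inE.
rewrite cardsT card_lattice !natrM.
rewrite big_split /= -mulr_suml -mulr_sumr -/S big_const_seq count_predT.
rewrite size_pairmap -/T iter_addr addr0 -mulr_natl sqrrD expr1n mulr1 => h.
have {}h : (2 * (m%:R * n%:R) - 4 * k ^+ 2 - 2 * S) * q%:R ^+ 2 <= C * q%:R.
  by rewrite /C; lra.
have {}h : (2 * (m%:R * n%:R) - 4 * k ^+ 2 - 2 * S) * q%:R <= C.
  by move: h; rewrite [q%:R ^+ 2]expr2 mulrA ler_pM2r // ltr0n.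
have : (2 * (m%:R * n%:R) - 4 * k ^+ 2 - 2 * S) < e.
  by rewrite -(ltr_pM2r (lt_le_trans ltr01 q1)); apply: le_lt_trans h qe.
lra.
Qed.

Lemma covering_path_feasible (R : realType) m n (k : R) F V : 0 < k ->
  2 * k ^+ 2 < (m * n)%:R -> covering_path m n k F V ->
  feasible m n k (poly_length V) (size F)%:R.
Proof.
move=> k0 hN [_ _ cov vis]; case: F cov vis => [|f F] cov vis.
  by have [|q] := cov 0; rewrite // /in_rect /= lexx !ler0n.
have hA := covering_area k0 cov; have hL := sum_l1dist_visits vis.
(* With a single stop the sum of [hA] is empty, which contradicts 2k^2 < mn. *)
case: F hA hL {cov vis} => [|g F] hA hL.
  by move: hA; rewrite /= big_nil; lra.
set T := size (f :: g :: F).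
have T1 : T%:R - 1 = (size (pairmap (@l1dist R) f (g :: F)))%:R :> R.
  by rewrite size_pairmap /T /= -natr1 addrK.
have T0 : 0 < T%:R - 1 :> R by rewrite T1 ltr0n.
have area : (m * n)%:R - 2 * k ^+ 2 <=
    (T%:R - 1) * cover_area k (poly_length V / (T%:R - 1)).
  apply: (le_trans hA); rewrite T1; apply: sum_cover_area_le => //.
  by rewrite -T1 mulrC divfK ?gt_eqF.
split=> //; first by rewrite ler_nat.
(* A path of length 0 would make the covered area term f(0) = 0, again against 2k^2 < mn. *)
rewrite lt_neqAle poly_length_ge0 andbT; apply/eqP => V0.
move: area; rewrite -V0 mul0r /cover_area mul0r.
case: (leP 0 (2 * k)) => h; [rewrite mulr0; lra | lra].
Qed.

(** * The up-and-down path *)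

Lemma heights_bounds (R : realType) m (d c h : R) : 0 < d -> 0 <= c ->
  h \in heights m d c -> 0 <= h <= m%:R.
Proof.
move=> d0 c0; rewrite mem_undup mem_rcons inE => /orP[/eqP->|].
  by rewrite ler0n lexx.
rewrite mem_filter => /andP[-> /mapP[j _ ->]].
by rewrite andbT addr_ge0 // mulr_ge0 ?ler0n // ltW.
Qed.

Lemma max_heights (R : realType) m (d c : R) : m%:R \in heights m d c.
Proof. by rewrite mem_undup mem_rcons inE eqxx. Qed.

Lemma mem_heights (R : realType) m (d c : R) j : 0 < d -> 0 <= c ->
  c + j%:R * d <= m%:R -> c + j%:R * d \in heights m d c.
Proof.
move=> d0 c0 h; rewrite mem_undup mem_rcons inE mem_filter h andTb.
apply/orP; right; apply/mapP; exists j => //.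
have le : j%:R <= m%:R / d by rewrite ler_pdivlMr //; lra.
by rewrite mem_iota /= add0n ltnS truncn_ge_nat // (le_trans _ le).
Qed.

(** If c + j d exceeds m, the additional stop at height m takes its place. *)
Lemma heights_above (R : realType) m (d c y : R) j : 0 < d -> 0 <= c ->
  y <= m%:R -> y <= c + j%:R * d ->
  exists2 h, h \in heights m d c & y <= h <= c + j%:R * d.
Proof.
move=> d0 c0 ym yc; case: (leP (c + j%:R * d) m%:R) => h.
  by exists (c + j%:R * d); [exact: mem_heights | rewrite yc lexx].
by exists m%:R; [exact: max_heights | rewrite ym ltW].
Qed.

Lemma sorted_heights (R : realType) m (d c : R) : 0 < d ->
  sorted <=%R (heights m d c).
Proof.
move=> d0; apply: (subseq_sorted le_trans (undup_subseq _)).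
rewrite -cats1 sorted_pairwise; last exact: le_trans.
rewrite pairwise_cat; apply/and3P; split=> //.
  apply/allrelP => x y; rewrite mem_filter => /andP[xm _].
  by rewrite inE => /eqP->.
apply/pairwise_filter; rewrite pairwise_map.
apply: (sub_pairwise (r := leq)).
  by move=> i j ij; rewrite /= lerD2l ler_pM2r ?ler_nat.
by rewrite -sorted_pairwise ?iota_sorted //; exact: leq_trans.
Qed.

Lemma size_heights (R : realType) m (d c : R) : 0 < d ->
  (size (heights m d c))%:R <= m%:R / d + 2.
Proof.
move=> d0; have m0 : 0 <= m%:R / d by rewrite divr_ge0 ?ler0n // ltW.
have : (Num.truncn (m%:R / d))%:R <= m%:R / d by rewrite truncn_le.
have : (size (heights m d c) <= (Num.truncn (m%:R / d)).+2)%N.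
  rewrite (leq_trans (size_undup _)) // size_rcons ltnS size_filter.
  by rewrite (leq_trans (count_size _ _)) // size_map size_iota.
rewrite -(ler_nat R) -!natr1; lra.
Qed.

(** Together the two progressions have step d/2 and alternate, so y lies between two consecutive
    terms, one of each kind. The parity of t = floor(2y/d) tells which kind is below; replacing an
    upper term beyond m by m only brings it closer to y. *)
Lemma heights_interleave (R : realType) m (d y : R) : 0 < d ->
  0 <= y <= m%:R ->
  exists h1 h2, [/\ h1 \in heights m d 0, h2 \in heights m d (d / 2)
                  & `|y - h1| + `|y - h2| <= d / 2].
Proof.
move=> d0 /andP[y0 ym].
have d2 : 0 < d / 2 by rewrite divr_gt0.
have yd : 0 <= y / (d / 2) by rewrite divr_ge0 // ltW.
have /andP[] := truncn_itv yd; rewrite ler_pdivlMr // ltr_pdivrMr //.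
move: (Num.truncn _) => t; set j := t./2.
have -> : t.+1%:R = (odd t)%:R + 2 * j%:R + 1 :> R.
  by rewrite -natr1 -[in LHS](odd_double_half t) natrD -mul2n natrM.
have -> : t%:R = (odd t)%:R + 2 * j%:R :> R.
  by rewrite -[in LHS](odd_double_half t) natrD -mul2n natrM.
case: (odd t) => h1 h2.
  have [||||h hm /andP[hy hj]] := @heights_above R m d 0 y j.+1 => //.
    by rewrite -natr1; move: h2; rewrite /=; lra.
  exists h, (d / 2 + j%:R * d); split => //.
    apply: mem_heights; rewrite ?(ltW d2) //; move: h1; rewrite /=; lra.
  move: hj; rewrite -natr1 => hj.
  by rewrite ler0_norm ?ger0_norm //; move: h1 => /=; lra.
have [||||h hm /andP[hy hj]] := @heights_above R m d (d / 2) y j => //.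
- exact: ltW.
- by move: h2; rewrite /=; lra.
exists (0 + j%:R * d), h; split => //.
  apply: mem_heights => //; move: h1; rewrite /=; lra.
by rewrite ger0_norm ?ler0_norm //; move: h1 => /=; lra.
Qed.

(** * Positions of the traversals *)

Lemma nth_traversals (R : realType) n (k d : R) i :
  (i < size (traversals n k d))%N ->
  (traversals n k d)`_i = i%:R * trav_gap k d \/
  [/\ n%:R / trav_gap k d \isn't a Num.int,
      i = (Num.truncn (n%:R / trav_gap k d)).+1 &
      (traversals n k d)`_i = n%:R].
Proof.
rewrite /traversals; set r := trav_gap k d; set t := Num.truncn _.
have nthE j : (j < t.+1)%N -> [seq i%:R * r | i <- iota 0 t.+1]`_j = j%:R * r.
  by move=> jt; rewrite (nth_map 0%N) ?size_iota // nth_iota.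
case: ifPn => hint; first by rewrite size_map size_iota => /nthE; left.
rewrite size_rcons size_map size_iota ltnS leq_eqVlt => /orP[/eqP->|it].
  by right; split=> //; rewrite nth_rcons size_map size_iota ltnn eqxx.
by left; rewrite nth_rcons size_map size_iota it nthE.
Qed.

Lemma traversals_head (R : realType) n (k d : R) : (traversals n k d)`_0 = 0.
Proof.
have [|->|[_ //]] := @nth_traversals R n k d 0; last by rewrite mul0r.
by rewrite /traversals; case: ifP; rewrite ?size_rcons size_map size_iota.
Qed.

Lemma traversals_last (R : realType) n (k d : R) : 0 < trav_gap k d ->
  (traversals n k d)`_(size (traversals n k d)).-1 = n%:R.
Proof.
move=> r0; rewrite /traversals; set r := trav_gap k d.
have nr0 : 0 <= n%:R / r by rewrite divr_ge0 ?ler0n // ltW.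
case: ifPn => hint; last first.
  by rewrite size_rcons /= nth_rcons ltnn eqxx.
rewrite size_map size_iota (nth_map 0%N) ?size_iota // nth_iota // add0n.
have : n%:R / r \is a Num.nat by rewrite natrEint hint.
by rewrite natrEtruncn => /eqP ->; rewrite divfK ?gt_eqF.
Qed.

Lemma size_traversals (R : realType) n (k d : R) : 0 < trav_gap k d ->
  (size (traversals n k d))%:R <= n%:R / trav_gap k d + 2.
Proof.
move=> r0; rewrite /traversals; set r := trav_gap k d.
have nr0 : 0 <= n%:R / r by rewrite divr_ge0 ?ler0n // ltW.
have : (Num.truncn (n%:R / r))%:R <= n%:R / r by rewrite truncn_le.
case: ifP => _; rewrite ?size_rcons size_map size_iota -!natr1; lra.
Qed.

Lemma traversals_gap (R : realType) n (k d : R) i : 0 < trav_gap k d ->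
  (i.+1 < size (traversals n k d))%N ->
  0 < (traversals n k d)`_i.+1 - (traversals n k d)`_i <= trav_gap k d.
Proof.
set r := trav_gap k d; set s := traversals n k d => r0 hi.
have nr0 : 0 <= n%:R / r by rewrite divr_ge0 ?ler0n // ltW.
have hi' := ltnW hi.
have /andP[t1 t2] := truncn_itv nr0.
have [E|[hint E ->]] := nth_traversals hi.
  have [E'|[_ E' _]] := nth_traversals hi'.
    by rewrite /s E E' -natr1 -/r; lra.
  move: hi; rewrite E' /s /traversals; case: ifP => _;
    by rewrite ?size_rcons size_map size_iota; lia.
have [->|[_ E' _]] := nth_traversals hi'; last by move: E; rewrite E'; lia.
(* The last gap runs from [truncn (n / r) * r] to n; it is positive because n / r is not an
   integer. *)
case: E => ->; rewrite -/r subr_gt0 lerBlDl.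
move: t2; rewrite ltr_pdivrMr // -natr1 mulrDl mul1r => /ltW ->.
rewrite andbT lt_neqAle -ler_pdivlMr // t1 andbT; apply: contraNneq hint => <-.
by rewrite mulfK ?gt_eqF // intr_nat.
Qed.

Lemma traversals_sorted (R : realType) n (k d : R) : 0 < trav_gap k d ->
  sorted <%R (traversals n k d).
Proof.
by move=> r0; apply/(sortedP 0) => i /(traversals_gap r0) /andP[]; rewrite subr_gt0.
Qed.

Lemma traversals_bounds (R : realType) n (k d : R) i : 0 < trav_gap k d ->
  (i < size (traversals n k d))%N -> 0 <= (traversals n k d)`_i <= n%:R.
Proof.
move=> r0 hi; have srt := sub_sorted (@ltW _ R) (traversals_sorted n r0).
rewrite -[X in X <= _](traversals_head n k d) -(traversals_last n r0).
apply/andP; split; apply: (sorted_leq_nth le_trans lexx 0 srt) => //; rewrite ?inE.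
all: by move: hi; case: (size _) => [|l] //=; rewrite ?ltnS // => _; rewrite ltnS.
Qed.

Lemma seq_bracket (R : realType) (s : nat -> R) t x :
  (0 < t)%N -> s 0%N <= x <= s t ->
  exists2 i, (i < t)%N & s i <= x <= s i.+1.
Proof.
elim: t => // -[|t] IH _ /andP[h0 h1]; first by exists 0%N; rewrite ?h0.
case: (leP x (s t.+1)) => h; last by exists t.+1; rewrite // h1 ltW.
by have [|i it hi] := IH isT; [rewrite h0 | exists i => //; exact: ltnW].
Qed.

(** * Stops: distinctness and coverage *)

Definition stop_heights (R : realType) m (d : R) (i : nat) : seq R :=
  if odd i then rev (heights m d (d / 2)) else heights m d 0.

Lemma updown_stopsE (R : realType) m n (k d : R) :
  updown_stops m n k d = [seq ((traversals n k d)`_i, h) |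
    i <- iota 0 (size (traversals n k d)), h <- stop_heights m d i].
Proof. by []. Qed.

Lemma stop_heights_bounds (R : realType) m (d h : R) i : 0 < d ->
  h \in stop_heights m d i -> 0 <= h <= m%:R.
Proof.
move=> d0; rewrite /stop_heights; case: ifP => _; rewrite ?mem_rev;
  by apply: heights_bounds; rewrite // divr_ge0 // ltW.
Qed.

Lemma updown_stops_in (R : realType) m n (k d : R) : 0 < d ->
  0 < trav_gap k d -> all (in_rect m n) (updown_stops m n k d).
Proof.
move=> d0 r0; rewrite updown_stopsE; apply/allP => p.
case/allpairsPdep=> i [h [hi hh ->]].
move: hi; rewrite mem_iota add0n => /andP[_ hi].
by rewrite /in_rect /= (stop_heights_bounds d0 hh) traversals_bounds.
Qed.

(** Stops on different traversals differ in abscissa, as [traversals] is strictly increasing. *)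
Lemma updown_stops_uniq (R : realType) m n (k d : R) :
  0 < trav_gap k d -> uniq (updown_stops m n k d).
Proof.
move=> r0; rewrite updown_stopsE; apply: allpairs_uniq_dep.
- exact: iota_uniq.
- by move=> i _; rewrite /stop_heights; case: ifP; rewrite ?rev_uniq undup_uniq.
move=> [i h] [i' h'] /allpairsPdep[a [b [ha _ /= ea]]].
move=> /allpairsPdep[a' [b' [ha' _ /= ea']]] /= [hs hh].
have {}ea := congr1 tag ea; have {}ea' := congr1 tag ea'.
move: ha ha'; rewrite -[a]ea -[a']ea' !mem_iota !add0n /= => hi hi'.
move/eqP: hs; rewrite nth_uniq // ?(sorted_uniq lt_trans ltxx) ?traversals_sorted //.
by move=> /eqP ei; subst i'; rewrite hh.
Qed.

Lemma updown_stops_cover (R : realType) m n (k d : R) p : (0 < n)%N -> 0 < d ->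
  0 < trav_gap k d -> in_rect m n p ->
  exists2 q, q \in updown_stops m n k d & l1dist p q <= k.
Proof.
move=> n0 d0 r0; case: p => x y; rewrite /in_rect /= => /andP[hx hy].
set s := traversals n k d.
have hd := traversals_head n k d; have hl := traversals_last n r0.
(* There are at least two traversals, the first being at 0 and the last at n > 0. *)
have ht : (0 < (size s).-1)%N.
  rewrite lt0n; apply/negP => /eqP E; move: hl; rewrite -/s E hd => /esym/eqP.
  by rewrite pnatr_eq0; case: (n) n0.
have [|i it /andP[h1 h2]] := @seq_bracket R (fun i => s`_i) _ x ht.
  by rewrite hd hl.
have it' : (i.+1 < size s)%N by lia.
have /andP[_ gap] := traversals_gap r0 it'.
have [ha [hb [ma mb hab]]] := heights_interleave d0 hy.
have stop j h : (j < size s)%N -> h \in stop_heights m d j ->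
    (s`_j, h) \in updown_stops m n k d.
  move=> js hj; rewrite updown_stopsE.
  by apply/allpairsPdep; exists j, h; split; rewrite ?mem_iota.
(* The distances from (x, y) to the two stops add up to at most
   gap + d/2 <= 2k, so one of them is at most k. *)
have key g h : g \in stop_heights m d i -> h \in stop_heights m d i.+1 ->
    `|y - g| + `|y - h| <= d / 2 ->
    exists2 q, q \in updown_stops m n k d & l1dist (x, y) q <= k.
  move=> hg hh hgh; move: gap; rewrite -/s /trav_gap => gap.
  case: (leP (x - s`_i + `|y - g|) k) => h3.
    by exists (s`_i, g); [exact: stop (ltnW it') hg
                         | rewrite /l1dist /= ger0_norm ?subr_ge0].
  exists (s`_i.+1, h); first exact: stop it' hh.
  by rewrite /l1dist /= ler0_norm ?subr_le0 //; lra.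
case: (boolP (odd i)) => oi.
  by apply: (key hb ha); rewrite /stop_heights /= ?oi /= ?mem_rev // addrC.
by apply: (key ha hb); rewrite /stop_heights /= ?(negbTE oi) /= ?mem_rev.
Qed.

(** * Vertices, length, stop count and order of the visits *)

Lemma poly_point_nth (R : realType) (V : seq (R * R)) i (t : R) :
  (i.+1 < size V)%N -> 0 <= t <= 1 ->
  poly_point V (i%:R + t) =
  ((V`_i).1 + t * ((V`_i.+1).1 - (V`_i).1),
   (V`_i).2 + t * ((V`_i.+1).2 - (V`_i).2)).
Proof.
move=> hi /andP[t0 t1]; elim: i V hi => [|i IH] [|p [|q V]] // hi.
  by rewrite add0r poly_point_cons2 t1.
have i0 := ler0n R i.
rewrite poly_point_cons2 -natr1; case: (leP (i%:R + 1 + t) 1) => h; last first.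
  have -> : i%:R + 1 + t - 1 = i%:R + t by ring.
  exact: IH.
(* At an integer parameter [poly_point] still uses the edge that ends there; in this branch that
   leaves only the end of the first edge. *)
have i00 : i = 0%N by apply/eqP; rewrite -(pnatr_eq0 R); apply/eqP; lra.
have -> : t = 0 by lra.
subst i; rewrite /= add0r addr0 !mul1r !mul0r !addr0.
by congr (_, _); ring.
Qed.

(** Vertices 2i and 2i + 1 are the start and the end of traversal i, which runs up for even i and
    down for odd i; hence the exclusive or of the parities. *)
Definition updown_vertex (R : realType) m n (k d : R) (j : nat) : R * R :=
  ((traversals n k d)`_j./2, if odd j./2 (+) odd j then m%:R else 0).

Lemma updown_verticesE (R : realType) m n (k d : R) :
  updown_vertices m n k d =
  mkseq (updown_vertex m n k d) (size (traversals n k d)).*2.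
Proof.
rewrite /updown_vertices; set s := traversals n k d.
have flat (T : Type) (f : nat -> T) a l :
    flatten [seq [:: f i.*2; f i.*2.+1] | i <- iota a l] =
    [seq f j | j <- iota a.*2 l.*2].
  by elim: l a => //= l IH a; rewrite IH.
rewrite /mkseq -(flat _ _ 0%N); congr flatten; apply: eq_map => i.
rewrite /updown_vertex -/s /= doubleK uphalf_double odd_double.
by case: (odd i).
Qed.

(** Each traversal contributes m, and the horizontal edges telescope to the abscissa n of the last
    traversal. *)
Lemma updown_length (R : realType) m n (k d : R) : 0 < trav_gap k d ->
  poly_length (updown_vertices m n k d)
    <= (size (traversals n k d))%:R * m%:R + n%:R.
Proof.
move=> r0; rewrite updown_verticesE /poly_length size_mkseq.
set s := traversals n k d.
rewrite -(traversals_last n r0) -/s.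
case E : (size s) => [|S].
  by rewrite /= big_ord0 mul0r add0r nth_default // E.
have -> : (S.+1.*2).-1 = S.*2.+1 by [].
rewrite -[S.+1.-1]/S.
suff H l : (l <= S)%N -> \sum_(i < l.*2.+1)
    l1dist (updown_vertex m n k d i.+1) (updown_vertex m n k d i)
    = l.+1%:R * m%:R + s`_l.
  rewrite -H //; apply: ler_sum => i _.
  by rewrite !nth_mkseq //; have := ltn_ord i; lia.
have vert j : l1dist (updown_vertex m n k d j.*2.+1) (updown_vertex m n k d j.*2)
    = m%:R.
  rewrite /l1dist /updown_vertex /= doubleK uphalf_double odd_double.
  rewrite subrr normr0 add0r; case: (odd j) => /=.
    by rewrite sub0r normrN normr_nat.
  by rewrite subr0 normr_nat.
elim: l => [|l IH] hl.
  by rewrite big_ord_recl big_ord0 (vert 0%N) (traversals_head n k d) mul1r.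
rewrite doubleS big_ord_recr big_ord_recr /= IH ?(ltnW hl) //.
have -> : updown_vertex m n k d l.*2.+3 = updown_vertex m n k d l.+1.*2.+1 by [].
have -> : updown_vertex m n k d l.*2.+2 = updown_vertex m n k d l.+1.*2 by [].
rewrite vert /l1dist /updown_vertex doubleK /= uphalf_double odd_double /=.
have hl' : (l.+1 < size s)%N by rewrite E.
have /andP[g0 _] := traversals_gap r0 hl'.
rewrite -/s ger0_norm; last exact: ltW.
by case: (odd l) => /=; rewrite subrr normr0 -[l.+2%:R]natr1; ring.
Qed.

Lemma size_updown_stops (R : realType) m n (k d : R) : 0 < d ->
  (size (updown_stops m n k d))%:R
    <= (size (traversals n k d))%:R * (m%:R / d + 2).
Proof.
move=> d0; rewrite updown_stopsE size_allpairs_dep.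
rewrite -{2}(size_iota 0 (size _)); elim: (iota _ _) => [|i l IH] /=.
  by rewrite mul0r.
rewrite natrD -natr1 mulrDl mul1r addrC lerD //.
by rewrite /stop_heights; case: ifP => _; rewrite ?size_rev size_heights.
Qed.

(** [2i, 2i + 1] will be the parameter interval of traversal i; these intervals follow one another,
    so sorted blocks inside them concatenate to a sorted list. *)
Lemma sorted_flatten_itv (R : realType) (g : nat -> seq R) a l :
  (forall i, sorted <=%R (g i)) ->
  (forall i, all (fun u => i.*2%:R <= u <= i.*2.+1%:R) (g i)) ->
  sorted <=%R (flatten [seq g i | i <- iota a l]).
Proof.
move=> srt itv; elim: l a => //= l IH a.
move: (IH a.+1) (srt a); rewrite !(sorted_pairwise le_trans).
rewrite pairwise_cat => -> ->; rewrite !andbT.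
apply/allrelP => x y /(allP (itv a))/andP[_ xa] /flattenP[z /mapP[i hi ->]].
move/(allP (itv i))/andP=> [iy _]; apply: (le_trans xa); apply: le_trans iy.
by move: hi; rewrite mem_iota ler_nat; lia.
Qed.

Lemma updown_visits (R : realType) m n (k d : R) : (0 < m)%N -> 0 < d ->
  visits_in_order (updown_vertices m n k d) (updown_stops m n k d).
Proof.
move=> m0 d0; set s := traversals n k d.
have m0' : 0 < m%:R :> R by rewrite ltr0n.
(* [t i h] is the fraction of traversal i already run through at height h, counted from the top on
   the downward ones. *)
pose t i (h : R) : R := if odd i then 1 - h / m%:R else h / m%:R.
have t01 i h : h \in stop_heights m d i -> 0 <= t i h <= 1.
  move/(stop_heights_bounds d0)=> /andP[h0 hm].
  have a0 : 0 <= h / m%:R by rewrite divr_ge0 ?ler0n.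
  have a1 : h / m%:R <= 1 by rewrite ler_pdivrMr // mul1r.
  by rewrite /t; case: ifP => _; lra.
pose g i := [seq i.*2%:R + t i h | h <- stop_heights m d i].
have gitv i : all (fun u => i.*2%:R <= u <= i.*2.+1%:R) (g i).
  by apply/allP => u /mapP[h /t01 ht ->]; rewrite -[i.*2.+1%:R]natr1; lra.
exists (flatten [seq g i | i <- iota 0 (size s)]); split.
- apply: sorted_flatten_itv => // i; rewrite /g /t /stop_heights sorted_map.
  case: ifP => _; last first.
    apply: sub_sorted (sorted_heights m 0 d0) => x y xy /=.
    by rewrite lerD2l ler_pM2r ?invr_gt0.
  rewrite rev_sorted; apply: sub_sorted (sorted_heights m (d / 2) d0).
  by move=> x y xy /=; rewrite lerD2l lerD2l lerN2 ler_pM2r ?invr_gt0.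
- apply/allP => u /flattenP[z /mapP[i hi ->]] /(allP (gitv i))/andP[h1 h2].
  rewrite (le_trans _ h1) ?ler0n //= (le_trans h2) // ler_nat.
  by rewrite updown_verticesE size_mkseq -/s; move: hi; rewrite mem_iota; lia.
rewrite map_flatten -map_comp; congr flatten; apply/eq_in_map => i.
rewrite mem_iota add0n => /andP[_ hi] /=; rewrite -map_comp.
apply/eq_in_map => h hh; rewrite /= updown_verticesE.
rewrite poly_point_nth ?t01 //; last first.
  by rewrite size_mkseq ltn_Sdouble.
rewrite !nth_mkseq ?ltn_Sdouble ?ltn_double //.
rewrite /updown_vertex -/s /= doubleK uphalf_double odd_double /t.
rewrite subrr mulr0 addr0; congr (_, _).
by case: (odd i) => /=; field; rewrite gt_eqF.
Qed.

(** * Comparison with the optimum *)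

(** Write e = L / (T - 1) and r = 2k - d/2. In both cases f(e) = r d, so the area constraint reads
    mn - 2k^2 <= (T - 1) r d, and (T - 1) d <= L turns it into the bound on r L. *)
Lemma feasible_gap (R : realType) m n (k L T : R) : 0 < k ->
  feasible m n k L T ->
  let d := Num.min (L / (T - 1)) (2 * k) in
  [/\ 0 < d <= 2 * k, (m * n)%:R - 2 * k ^+ 2 <= L * trav_gap k d
    & (m * n)%:R - 2 * k ^+ 2 <= (T - 1) * (trav_gap k d * d)].
Proof.
move=> k0 [area T2 L0] /=; move: area.
have T1 : 0 < T - 1 by lra.
have e0 : 0 < L / (T - 1) by rewrite divr_gt0.
have eL : L = (T - 1) * (L / (T - 1)) by rewrite mulrC divfK ?gt_eqF.
move: (L / (T - 1)) e0 eL => e e0 ->.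
rewrite /cover_area /trav_gap; case: (leP e (2 * k)) => he area.
  by rewrite e0; split=> //; apply: (le_trans area); lra.
(* For e > 2k one has d = 2k, r = k and f(e) = 2k^2, while L >= (T - 1) 2k. *)
have : (T - 1) * (2 * k) <= (T - 1) * e by rewrite ler_wpM2l // ltW.
move=> /(ler_wpM2r (ltW k0)) h.
by split; [lra | | ]; apply: (le_trans area); lra.
Qed.

(** The left sides are the bounds on the path length times r and on the stop count times r d. Their
    terms other than mn, together with (1 + eps) 2k^2, stay below 7 k m, while 16 k m <= eps m n. *)
Lemma updown_ratio (R : realType) (k eps n m d : R) : 0 < k -> 0 < eps < 1 ->
  16 * k <= n * eps -> n <= m -> 0 < d <= 2 * k ->
  n * m + 2 * m * trav_gap k d + n * trav_gap k d
    <= (1 + eps) * (m * n - 2 * k ^+ 2) /\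
  (n + 2 * trav_gap k d) * (m + 2 * d) <= (1 + eps) * (m * n - 2 * k ^+ 2).
Proof.
move=> k0 /andP[e0 e1] hn nm /andP[d0 d2]; rewrite /trav_gap.
have n0 : 0 < n by rewrite -(pmulr_lgt0 _ e0); lra.
have kn : 16 * k <= n by rewrite (le_trans hn) // ler_piMr // ltW.
have h1 : 16 * k * m <= m * n * eps.
  by rewrite mulrC -mulrA ler_wpM2l //; lra.
have h2 : 16 * k ^+ 2 <= k * m by rewrite expr2; nra.
have h3 : eps * k ^+ 2 <= k ^+ 2 by rewrite ler_piMl ?sqr_ge0 // ltW.
have h4 : 0 <= d * m by rewrite mulr_ge0 ?ltW //; lra.
have h5 : 0 <= d * n by rewrite mulr_ge0 ?ltW.
have h6 : k * n <= k * m by rewrite ler_wpM2l // ltW.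
have h7 : d * n <= 2 * k * n by rewrite ler_wpM2r // ltW.
have h8 := sqr_ge0 (d - 2 * k).
have h9 : 0 <= k * d by rewrite mulr_ge0 ?ltW.
have h10 := sqr_ge0 k.
have h11 : d ^+ 2 >= 0 by exact: sqr_ge0.
split; lra.
Qed.

Theorem theorem3 (R : realType) (m n : nat) (k eps alpha beta : R)
  (TT : R -> Prop) (Lstar Tstar : R)
  (hn : (1 <= n)%N) (hmn : (n <= m)%N)
  (hk : 0 < k) (heps0 : 0 < eps) (heps1 : eps < 1)
  (halpha : 0 < alpha) (hbeta : 0 < beta)
  (hnk : 16 * k / eps <= n%:R)
  (hTT : (forall T, TT T) \/ (forall T, TT T <-> exists t : nat, T = t%:R))
  (hopt : optimal m n k alpha beta TT Lstar Tstar) :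
  let dstar := Num.min (Lstar / (Tstar - 1)) (2 * k) in
  let F' := updown_stops m n k dstar in
  let V' := updown_vertices m n k dstar in
  covering_path m n k F' V' /\
  forall F V : seq (R * R), covering_path m n k F V ->
    cost alpha beta (poly_length V') (size F')%:R
      <= (1 + eps) * cost alpha beta (poly_length V) (size F)%:R.
Proof.
case: hopt => feas _ opt; have [] := feasible_gap hk feas.
move: (Num.min _ _) => d /= d02 hL hT.
have /andP[d0 d2] := d02.
have m0 : (0 < m)%N by exact: leq_trans hn hmn.
have r0 : 0 < trav_gap k d by rewrite /trav_gap; lra.
have nm : n%:R <= m%:R :> R by rewrite ler_nat.
rewrite ler_pdivrMr // in hnk.
have heps : 0 < eps < 1 by rewrite heps0.
have [ratioL ratioT] := updown_ratio hk heps hnk nm d02.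
split.
  split; [exact: updown_stops_uniq | exact: updown_stops_in | |
          exact: updown_visits].
  by move=> p; exact: updown_stops_cover.
move=> F V cov.
have hN : 2 * k ^+ 2 < (m * n)%:R.
  have kn : 16 * k <= n%:R by rewrite (le_trans hnk) // ler_piMr // ltW.
  by rewrite natrM; nra.
have feasF := covering_path_feasible hk hN cov.
(* A stop count is a natural number, hence an allowed value whether [TT] holds everywhere or exactly
   on the naturals. *)
have TTF : TT (size F)%:R by case: hTT => // hTT; apply/hTT; exists (size F).
rewrite natrM in hL hT.
have eps1 : 0 < 1 + eps by lra.
have sz := size_traversals n r0.
(* After multiplication by r the bound on the length becomes the first left side of [updown_ratio];
   the stop count is treated likewise with r d. *)
have lenL : poly_length (updown_vertices m n k d) <= (1 + eps) * Lstar.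
  rewrite -(ler_pM2r r0) -mulrA; apply: le_trans (ler_wpM2l (ltW eps1) hL).
  apply: le_trans ratioL.
  have -> : n%:R * m%:R + 2 * m%:R * trav_gap k d + n%:R * trav_gap k d =
    ((n%:R / trav_gap k d + 2) * m%:R + n%:R) * trav_gap k d.
    by field; rewrite gt_eqF.
  rewrite ler_pM2r //; apply: le_trans (updown_length m n r0) _.
  by rewrite lerD2r ler_wpM2r.
have sizeT : (size (updown_stops m n k d))%:R <= (1 + eps) * Tstar.
  have rd0 : 0 < trav_gap k d * d by rewrite mulr_gt0.
  have : (size (updown_stops m n k d))%:R <= (1 + eps) * (Tstar - 1).
    rewrite -(ler_pM2r rd0) -mulrA; apply: le_trans (ler_wpM2l (ltW eps1) hT).
    apply: le_trans ratioT.
    have md0 : 0 <= m%:R / d + 2.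
      by rewrite addr_ge0 // divr_ge0 ?ler0n // ltW.
    have h := le_trans (size_updown_stops m n k d0) (ler_wpM2r md0 sz).
    have -> : (n%:R + 2 * trav_gap k d) * (m%:R + 2 * d) =
      (n%:R / trav_gap k d + 2) * (m%:R / d + 2) * (trav_gap k d * d).
      by field; rewrite !gt_eqF.
    by rewrite ler_pM2r.
  lra.
(* Every covering path is a feasible point, so its cost is at least that of the optimum, to which
   length and stop count were compared separately. *)
have := opt _ _ feasF TTF; rewrite -(ler_pM2l eps1); apply: le_trans.
rewrite /cost mulrDr !(mulrCA (1 + eps)).
by rewrite lerD // ler_pM2l.
Qed.
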